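(* Let $v$ be a leaf of the path $P_n$. Then, for $n\ge 4$, $$X_{P_{n,v}}=2(n+1)e_{n+1}+2\sum_{j=3}^{n}(j-1)e_jX_{P_{n+1-j}}.$$ Thus $X_{P_{n,v}}$ is $e$-positive. Moreover, for $n\ge 4$, $X_{P_{n,v}}$ satisfies the $e$-positive recurrence $$X_{P_{n,v}}=\sum_{j=2}^{n-2}(j-1)e_jX_{P_{n-j,v}}+2(n+1)e_{n+1}+2(n-1)e_ne_1+2(n-3)e_{n-1}e_2,$$ with initial values $X_{P_{1,v}}=2e_2$, $X_{P_{2,v}}=6e_3$, and $X_{P_{3,v}}=8e_4+4e_3e_1$.
   Context: The chromatic symmetric function of a finite simple graph $H=(V,E)$ is $X_H=\sum_\kappa\prod_{u\in V}x_{\kappa(u)}$, the sum over all proper colorings $\kappa:V\to\mathbb{Z}_{>0}$. $P_n$ is the path on $n$ vertices. The twin of a graph at a vertex $v$ is obtained by adding a new vertex $v'$ joined to $v$ and to all neighbors of $v$. $P_{n,v}$ denotes $P_n$ twinned at an end vertex $v$ (for $n=1$, the only vertex). $e_i$ is the $i$-th elementary symmetric function; a symmetric function is $e$-positive if its expansion in the basis of elementary symmetric functions has nonnegative coefficients. *)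

(* Defs.v *)
From HB Require Import structures.
From mathcomp Require Import all_boot all_order all_algebra.
From mathcomp Require Import finmap multiset.
From mathcomp Require Import boolp functions.

Set Implicit Arguments.
Unset Strict Implicit.
Unset Printing Implicit Defensive.

Import Order.TTheory GRing.Theory Num.Theory.
Local Open Scope mset_scope.
Local Open Scope ring_scope.

(** * Formal power series in countably many variables

   A monomial is a finite multiset of variable indices, i.e. [m : {mset nat}]
   stands for the product of the variables [x_i ^ (m i)].  The variables are
   indexed by [nat] instead of the positive integers. *)

Definition submsets (m : {mset nat}) : {fset {mset nat}} :=
  [fset seq_mset (mask (tval b) (enum_mset m)) | b : (size m).-tuple bool]%fset.

Lemma in_submsets (m a : {mset nat}) : (a \in submsets m) = (a `<=` m)%mset.
Proof.
apply/imfsetP/msubsetP => [[b _ ->] i|am] /=.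
  rewrite mset_seqE -[leqRHS]count_mem_mset.
  by apply: leq_count_subseq; apply: mask_subseq.
have /count_subseqP[s /subseqP[b sb ->] pas] : forall x : nat,
    (count_mem x (enum_mset a) <= count_mem x (enum_mset m))%N.
  by move=> x; rewrite !count_mem_mset.
exists (tcast sb (in_tuple b)) => //.
rewrite val_tcast /= -[LHS]seq_mset_id; exact/eq_seq_msetP.
Qed.

Definition fps : Type := {mset nat} -> int.

HB.instance Definition _ := GRing.Zmodule.copy fps ({mset nat} -> int).

Definition fps_one : fps := fun m => (m == mset0)%:Z.

Definition fps_mul (f g : fps) : fps :=
  fun m => \sum_(a <- submsets m) f a * g (m `\` a)%mset.

Section FpsRing.
Implicit Types (f g h : fps) (m a b : {mset nat}).

Lemma fpsD f g m : (f + g) m = f m + g m. Proof. by []. Qed.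

Lemma msubset_addl m a b : (a `+` b = m -> a `<=` m)%mset.
Proof. by move=> <-; apply/msubsetP => x; rewrite msetE2 leq_addr. Qed.

Lemma msubset_addr m a b : (a `+` b = m -> b `<=` m)%mset.
Proof. by rewrite msetDC; apply: msubset_addl. Qed.

Lemma fps_mulE_pick (D : {fset {mset nat}}) (a0 : {mset nat})
    (F : {mset nat} -> int) :
  \sum_(a <- D) (if a == a0 then F a else 0) = if a0 \in D then F a0 else 0.
Proof.
rewrite -big_mkcond /=; case: ifPn => a0D.
  by rewrite -big_filter filter_pred1_uniq ?fset_uniq// big_seq1.
by rewrite big_seq_cond big1// => a /andP[aD /eqP aa0]; rewrite -aa0 aD in a0D.
Qed.

(* The summation range may be enlarged to the divisors of any multiple [M]. *)
Lemma fps_mulE f g m (M : {mset nat}) : (m `<=` M)%mset ->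
  fps_mul f g m = \sum_(a <- submsets M) \sum_(b <- submsets M)
    (if (a `+` b)%mset == m then f a * g b else 0).
Proof.
move=> mM; rewrite /fps_mul.
transitivity (\sum_(a <- submsets M)
    (if (a `<=` m)%mset then f a * g (m `\` a)%mset else 0)).
  rewrite -[RHS]big_mkcond /= -[RHS]big_filter; apply: perm_big.
  apply: uniq_perm; rewrite ?filter_uniq ?fset_uniq// => a.
  rewrite mem_filter !in_submsets.
  by case: (boolP (a `<=` m)%mset) => //= am; rewrite (msubset_trans am mM).
apply: eq_bigr => a _; case: ifPn => am.
  have bM : (m `\` a)%mset \in submsets M.
    rewrite in_submsets; apply: msubset_trans mM.
    by apply/msubsetP => x; rewrite msetE2 leq_subr.
  have := fps_mulE_pick (submsets M) (m `\` a)%mset (fun b => f a * g b).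
  rewrite bM => <-; apply: eq_bigr => b _.
  congr (if _ then _ else _); apply/eqP/eqP => [->|<-].
    by rewrite msetBDKC.
  by apply/msetP => x; rewrite !msetE2 addKn.
rewrite big1// => b _; case: eqP => // /msubset_addl abm.
by rewrite abm in am.
Qed.

Lemma fps_mulC : commutative fps_mul.
Proof.
move=> f g; apply/funext => m.
rewrite !(fps_mulE _ _ (msubset_refl m)) exchange_big /=.
by do 2!apply: eq_bigr => ? _; rewrite msetDC mulrC.
Qed.

Lemma fps_mulE3 f g h m :
  fps_mul (fps_mul f g) h m = \sum_(a <- submsets m) \sum_(b <- submsets m)
    \sum_(c <- submsets m)
      (if (a `+` b `+` c)%mset == m then f a * g b * h c else 0).
Proof.
rewrite (fps_mulE _ _ (msubset_refl m)).
transitivity (\sum_(d <- submsets m) \sum_(c <- submsets m)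
   \sum_(a <- submsets m) \sum_(b <- submsets m)
   (if d == (a `+` b)%mset then
     (if (d `+` c)%mset == m then f a * g b * h c else 0) else 0)).
  rewrite big_seq [RHS]big_seq; apply: eq_bigr => d; rewrite in_submsets => dm.
  apply: eq_bigr => c _; rewrite (fps_mulE _ _ dm).
  case: ifP => _; last by rewrite big1// => a _; rewrite big1// => b _; case: ifP.
  rewrite mulr_suml; apply: eq_bigr => a _; rewrite mulr_suml.
  by apply: eq_bigr => b _; rewrite eq_sym; case: ifP; rewrite ?mul0r.
rewrite exchange_big /=.
under eq_bigr do rewrite exchange_big /=.
rewrite exchange_big /=; apply: eq_bigr => a _.
under eq_bigr do rewrite exchange_big /=.
rewrite exchange_big /=; apply: eq_bigr => b _; apply: eq_bigr => c _.
rewrite (fps_mulE_pick _ _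
  (fun d => if (d `+` c)%mset == m then f a * g b * h c else 0)).
rewrite in_submsets; case: ifPn => // abm; case: eqP => // /msubset_addl abm'.
by rewrite abm' in abm.
Qed.

Lemma fps_mulA : associative fps_mul.
Proof.
move=> f g h; apply/funext => m.
rewrite [LHS](_ : _ = fps_mul (fps_mul g h) f m); last by rewrite fps_mulC.
rewrite !fps_mulE3.
under eq_bigr do rewrite exchange_big /=.
rewrite exchange_big /=; do 3!apply: eq_bigr => ? _.
by rewrite [X in X == _]msetDC msetDA mulrC mulrA.
Qed.

Lemma fps_mul1 : left_id fps_one fps_mul.
Proof.
move=> f; apply/funext => m; rewrite /fps_mul /fps_one.
transitivity (\sum_(a <- submsets m)
    (if a == mset0 then f (m `\` a)%mset else 0)).
  by apply: eq_bigr => a _; case: eqP; rewrite ?mul1r ?mul0r.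
rewrite (fps_mulE_pick _ _ (fun a => f (m `\` a)%mset)) in_submsets.
rewrite ifT; last by apply/msubsetP => x; rewrite mset0E.
by congr f; apply/msetP => x; rewrite msetE2 mset0E subn0.
Qed.

Lemma fps_mulDl : left_distributive fps_mul +%R.
Proof.
move=> f g h; apply/funext => m; rewrite fpsD /fps_mul -big_split /=.
by apply: eq_bigr => a _; rewrite -mulrDl.
Qed.

Lemma fps_one_neq0 : fps_one != 0.
Proof.
by apply/eqP => /(congr1 (@^~ mset0)); rewrite /fps_one eqxx.
Qed.

End FpsRing.

HB.instance Definition _ := GRing.Zmodule_isComNzRing.Build fps
  fps_mulA fps_mulC fps_mul1 fps_mulDl fps_one_neq0.

(** * Elementary symmetric functions *)

(* The sum of all products of [k] distinct variables. *)
Definition elsym (k : nat) : fps :=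
  fun m => ((size m == k) && uniq (enum_mset m))%:Z.

Definition is_partition (la : seq nat) : bool :=
  sorted geq la && (0%N \notin la).

Arguments elsym k%_N.

Definition elsym_part (la : seq nat) : fps := \prod_(i <- la) elsym i.

Definition e_expansion (f : fps) (c : {fsfun seq nat -> int with 0}) : Prop :=
  (forall la, la \in finsupp c -> is_partition la) /\
  f = \sum_(la <- finsupp c) (c la)%:~R * elsym_part la.

(* The [e_la] being linearly independent, an e-expansion is unique. *)
Definition e_positive (f : fps) : Prop :=
  exists c : {fsfun seq nat -> int with 0},
    e_expansion f c /\ (forall la, 0 <= c la).

(** * Finite simple graphs *)

Record sgraph := SGraph {
  vertex :> finType;
  adj : rel vertex;
  adj_sym : symmetric adj;
  adj_irr : irreflexive adj }.

Definition proper_coloring (G : sgraph) (T : eqType) (k : G -> T) : bool :=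
  [forall u : G, forall w : G, adj u w ==> (k u != k w)].

Definition coloring_monomial (G : sgraph) (k : G -> nat) : {mset nat} :=
  seq_mset (codom k).

Lemma coloring_supp (G : sgraph) (k : G -> nat) (u : G) :
  k u \in finsupp (coloring_monomial k).
Proof. by rewrite msuppE (perm_mem (perm_eq_seq_mset _)) codom_f. Qed.

(* The coefficient of [m] is the number of proper colorings with monomial [m];
   by [coloring_supp] these only use the finitely many colors occurring in
   [m]. *)
Definition chromsym (G : sgraph) : fps := fun m =>
  #|[set k : {ffun G -> finsupp m} | proper_coloring (fun u => val (k u)) &&
       (coloring_monomial (fun u => val (k u)) == m)]|%:Z.

Definition leaf (G : sgraph) (v : G) : bool := #|[set w | adj v w]| == 1%N.

Definition path_adj (n : nat) : rel 'I_n :=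
  fun i j => (i.+1 == j :> nat) || (j.+1 == i :> nat).

Lemma path_adj_sym n : symmetric (@path_adj n).
Proof. by move=> i j; rewrite /path_adj orbC. Qed.

Lemma path_adj_irr n : irreflexive (@path_adj n).
Proof. by move=> i; rewrite /path_adj orbb gtn_eqF. Qed.

Definition path_graph (n : nat) : sgraph :=
  SGraph (@path_adj_sym n) (@path_adj_irr n).

(* [None] is the new vertex v'. *)
Definition twin_adj (G : sgraph) (v : G) : rel (option G) :=
  fun a b => match a, b with
  | Some x, Some y => adj x y
  | None, Some y => (y == v) || adj v y
  | Some x, None => (x == v) || adj v x
  | None, None => false
  end.

Lemma twin_adj_sym (G : sgraph) (v : G) : symmetric (twin_adj v).
Proof. by case=> [x|] [y|] //=; rewrite adj_sym. Qed.

Lemma twin_adj_irr (G : sgraph) (v : G) : irreflexive (twin_adj v).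
Proof. by case=> [x|] //=; rewrite adj_irr. Qed.

Definition twin (G : sgraph) (v : G) : sgraph :=
  SGraph (@twin_adj_sym G v) (@twin_adj_irr G v).

(* The path on [n] vertices twinned at the chosen vertex [v n.-1] of ['I_n];
   the value at [n = 0], where there is no vertex to twin, is irrelevant. *)
Definition twin_path (v : forall m : nat, path_graph m.+1) (n : nat) : sgraph :=
  if n is m.+1 then twin (v m) else path_graph 0.

(* Main.v *)
Require Import Defs.
From HB Require Import structures.
From mathcomp Require Import all_boot all_order all_algebra.
From mathcomp Require Import finmap multiset.
From mathcomp Require Import boolp functions.
From mathcomp Require Import ring zify.

Set Implicit Arguments.
Unset Strict Implicit.
Unset Printing Implicit Defensive.

Import Order.TTheory GRing.Theory Num.Theory.

(** Over a finite alphabet the chromatic symmetric function of [P_n] is the sum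
    [W_n] of all words of length [n] without equal adjacent letters.  Consider
    pairs ([S], [w]) of a [j]-subset and such a word.  If an element of [S] is
    marked, either it differs from the first letter of [w] and can be moved in
    front of [w], or it is that first letter and the mark carries no
    information; hence [\sum_j j e_j W_(n-j) = \sum_(j < n) e_j W_(n-j)], that is,
    [W_n = e_n + \sum_(j >= 2) (j - 1) e_j W_(n-j)].  In the twinned path the
    vertices [v] and [v'] form a triangle with the next vertex, and
    inclusion-exclusion over the two edges to that vertex gives
    [X_(P_(n,v)) = 2 (X_(P_(n+1)) - e_2 X_(P_(n-1)))].  Both formulas of the
    theorem follow by substituting the recurrence of [W].  Identities of power
    series are reduced to a finite alphabet by truncation, which is a ring
    morphism. *)

Local Open Scope mset_scope.
Local Open Scope ring_scope.

(** * Words without equal adjacent letters over a finite alphabet *)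

Section CommutativeRing.
Variables (R : comNzRingType) (T : finType) (x : T -> R).
Implicit Types (D S : {set T}) (a b c d : T).

Definition esum (k : nat) : R := \sum_(S : {set T} | #|S| == k) \prod_(i in S) x i.

(* Words without equal adjacent letters whose first letter is not in [D]. *)
Fixpoint word_sum (n : nat) (D : {set T}) : R :=
  if n is n'.+1 then \sum_(d | d \notin D) x d * word_sum n' [set d] else 1.

(* The last factor sums the words starting with [c]. *)
Definition marked_sum (n k : nat) : R :=
  \sum_(S : {set T} | #|S| == k) \sum_(c in S)
    (\prod_(i in S) x i) * (word_sum n set0 - word_sum n [set c]).

Lemma esum0 : esum 0 = 1.
Proof.
rewrite /esum (big_pred1 set0) ?big_set0// => S.
by rewrite cards_eq0.
Qed.

Lemma word_sumD1 n c :
  word_sum n.+1 set0 - word_sum n.+1 [set c] = x c * word_sum n [set c].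
Proof.
apply/eqP; rewrite subr_eq /= (bigD1 c) ?inE//=; apply/eqP; congr (_ + _).
by apply: eq_bigl => d; rewrite !inE.
Qed.

Lemma marked_sum0l k : marked_sum 0 k = 0.
Proof.
by rewrite /marked_sum big1// => S _; rewrite big1// => c _; rewrite /= subrr mulr0.
Qed.

Lemma marked_sum0r n : marked_sum n 0 = 0.
Proof.
rewrite /marked_sum big1// => S /eqP/cards0_eq ->.
by rewrite big1 // => c; rewrite inE.
Qed.

(** The first letter of the word lies either outside [S] or in [S]; the second case is what
    [marked_sum] collects. *)
Lemma esum_split (n k : nat) :
  esum k * word_sum n.+1 set0 = \sum_(S : {set T} | #|S| == k)
     (\prod_(i in S) x i) * (\sum_(c | c \notin S) x c * word_sum n [set c])
   + marked_sum n.+1 k.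
Proof.
rewrite /esum /marked_sum mulr_suml -big_split; apply: eq_bigr => S _ /=.
rewrite -mulr_sumr -mulrDr; congr (_ * _).
rewrite (eq_bigr _ (fun c _ => word_sumD1 n c)) addrC.
rewrite [LHS](bigID (mem S)) /=; congr (_ + _).
  by apply: eq_bigl => c; rewrite inE.
by apply: eq_bigl => c; rewrite inE.
Qed.

(** The factor [k.+1] marks an element [c] of [S]. Words starting with [c] give [marked_sum]; for
    the others [c] moves from [S] to the front of the word, leaving a [k]-subset that does not
    contain the new first letter. *)
Lemma esumS_split (n k : nat) :
  k.+1%:R * esum k.+1 * word_sum n set0 = \sum_(S : {set T} | #|S| == k)
     (\prod_(i in S) x i) * (\sum_(c | c \notin S) x c * word_sum n [set c])
   + marked_sum n k.+1.
Proof.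
rewrite /esum /marked_sum; apply/eqP; rewrite -subr_eq; apply/eqP.
rewrite -mulrA mulr_suml mulr_sumr -sumrB.
transitivity (\sum_(S : {set T} | #|S| == k.+1) \sum_(c in S)
    (\prod_(i in S) x i) * word_sum n [set c]).
  apply: eq_bigr => S /eqP SE.
  rewrite -{1}SE mulr_natl -sumr_const -sumrB.
  by apply: eq_bigr => c _; ring.
under [in RHS]eq_bigr do rewrite mulr_sumr.
rewrite (exchange_big_dep predT)//= [RHS](exchange_big_dep predT)//=.
apply: eq_bigr => c _.
(* For fixed [c], sets of size [k.+1] containing [c] correspond to sets of size [k] avoiding [c]. *)
rewrite (reindex_onto (fun S : {set T} => c |: S)
  (fun S : {set T} => S :\ c)) /=; last first.
  by move=> S /andP[_ cS]; rewrite setD1K.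
apply: eq_big => [S|S].
  have [cS|cS] := boolP (c \in S); rewrite ?andbF ?andbT.
    apply/negbTE; rewrite negb_and; apply/orP; right.
    by apply/eqP => /setP /(_ c); rewrite !inE eqxx cS.
  by rewrite setU1K// eqxx andbT cardsU1 cS setU11 andbT add1n eqSS.
move=> /andP[/andP[_ _] /eqP SE].
have cS : c \notin S by rewrite -SE !inE eqxx.
by rewrite big_setU1//=; ring.
Qed.

(** Splitting both sides makes the terms with first letter outside [S] coincide. The remaining
    marked sums agree after shifting [j] by one: the unmatched end terms have an empty word on the
    left and an empty set on the right, hence vanish. *)
Lemma word_sum_esum (n : nat) :
  \sum_(j < n) j.+1%:R * esum j.+1 * word_sum (n - j.+1) set0 =
  \sum_(j < n) esum j * word_sum (n - j) set0.
Proof.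
under eq_bigr do rewrite esumS_split.
under [RHS]eq_bigr => j _ do rewrite -(subnSK (ltn_ord j)) esum_split.
rewrite !big_split /=; congr (_ + _).
under [RHS]eq_bigr => j _ do rewrite (subnSK (ltn_ord j)).
case: n => [|n]; first by rewrite !big_ord0.
rewrite big_ord_recr/= subnn marked_sum0l addr0 big_ord_recl/= marked_sum0r add0r.
by apply: eq_bigr => j _.
Qed.

Lemma word_sum_rec (n : nat) :
  word_sum n.+1 set0 = esum n.+1 +
    \sum_(2 <= j < n.+2) (j - 1)%:R * esum j * word_sum (n.+1 - j) set0.
Proof.
(* The term [j = 0] on the right is the word sum to be isolated. Since [esum n.+1] occurs only on
   the left, one copy of it survives the subtraction that lowers the other coefficients from [j] to
   [j - 1]. *)
have := word_sum_esum n.+1; rewrite [RHS]big_ord_recl esum0 mul1r subn0.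
move/esym/eqP; rewrite -subr_eq0 -addrA addr_eq0 => /eqP ->.
have -> : \sum_(2 <= j < n.+2) (j - 1)%:R * esum j * word_sum (n.+1 - j) set0 =
    \sum_(j < n.+1) j%:R * esum j.+1 * word_sum (n.+1 - j.+1) set0.
  rewrite -(big_mkord predT (fun j => j%:R * esum j.+1 * word_sum (n.+1 - j.+1) set0)).
  rewrite [RHS]big_ltn// !mul0r add0r [LHS]big_add1.
  by apply: eq_bigr => j _; rewrite subn1.
rewrite !big_ord_recr /= subnn opprB.
have -> : \sum_(j < n) j.+1%:R * esum j.+1 * word_sum (n.+1 - j.+1) set0 =
    \sum_(j < n) j%:R * esum j.+1 * word_sum (n.+1 - j.+1) set0 +
    \sum_(j < n) esum (lift ord0 j) * word_sum (n.+1 - lift ord0 j) set0.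
  by rewrite -big_split; apply: eq_bigr => j _; rewrite -natr1 /=; ring.
by rewrite -natr1 /=; ring.
Qed.

(* For [a != b], avoiding both [a] and [b] is governed by inclusion-exclusion
   with no remainder, since no letter equals both. *)
Lemma word_sum2 n a b : a != b ->
  word_sum n.+1 [set a; b] =
  word_sum n.+1 [set a] + word_sum n.+1 [set b] - word_sum n.+1 set0.
Proof.
move=> ab; have := word_sumD1 n a; have := word_sumD1 n b.
have ba : b \notin [set a] by rewrite inE eq_sym.
have -> : word_sum n.+1 [set a] =
    x b * word_sum n [set b] + word_sum n.+1 [set a; b].
  rewrite /= (bigD1 b)//=; congr (_ + _).
  by apply: eq_bigl => d; rewrite !inE negb_or.
move=> <- _; ring.
Qed.

(** This encodes colorings of the path on [n.+1] vertices twinned at an end: [a] colors the new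
    vertex, [b] the end vertex, and the other [n] vertices form a word whose first letter avoids
    both. *)
Definition twin_sum (n : nat) : R :=
  \sum_a \sum_(b | b != a) x a * x b * word_sum n [set a; b].

Lemma word_sumSS n : word_sum n.+2 set0 =
  \sum_a \sum_(b | b != a) x a * x b * word_sum n [set b].
Proof.
apply: eq_big => [a|a _]; first by rewrite inE.
rewrite mulr_sumr; apply: eq_big => [b|b _]; first by rewrite inE.
by rewrite mulrA.
Qed.

Lemma twin_sum0 : twin_sum 0 = word_sum 2 set0.
Proof. by rewrite word_sumSS. Qed.

(** After inclusion-exclusion, the terms avoiding only [a] or only [b] each give all words of length
    [n.+3], the roles of [a] and [b] being exchanged, while the unrestricted term factors. *)
Lemma twin_sumS n :
  twin_sum n.+1 =
  2%:R * word_sum n.+3 set0 - word_sum 2 set0 * word_sum n.+1 set0.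
Proof.
rewrite /twin_sum; transitivity
  (\sum_a \sum_(b | b != a) (x a * x b * word_sum n.+1 [set a]
     + x a * x b * word_sum n.+1 [set b]
     - x a * x b * word_sum n.+1 set0)).
  apply: eq_bigr => a _; apply: eq_bigr => b ba.
  by rewrite word_sum2 1?eq_sym//; ring.
under eq_bigr do rewrite sumrB big_split.
rewrite sumrB big_split -word_sumSS; congr (_ - _).
  rewrite mulr_natl mulr2n; congr (_ + _).
  rewrite word_sumSS (exchange_big_dep predT)//.
  apply: eq_bigr => a _; apply: eq_big => [b|b _]; first by rewrite eq_sym.
  by rewrite [x b * _]mulrC.
rewrite word_sumSS mulr_suml.
by apply: eq_bigr => a _; rewrite mulr_suml; apply: eq_bigr => b _; rewrite mulr1.
Qed.

End CommutativeRing.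

(** * Truncation of power series to finitely many variables *)

Definition color_sum (R : comNzRingType) (T : finType) (x : T -> R) (G : sgraph) : R :=
  \sum_(k : {ffun G -> T} | proper_coloring k) \prod_u x (k u).

Definition monom (m : {mset nat}) : fps := fun m' => (m' == m)%:Z.

Lemma monomD (a b : {mset nat}) : monom (a `+` b)%mset = monom a * monom b.
Proof.
apply/funext => m; rewrite [RHS](_ : _ = \sum_(a' <- submsets m)
   (if a' == a then monom b (m `\` a')%mset else 0)); last first.
  by apply: eq_bigr => a' _; rewrite /monom; case: eqP; rewrite ?mul1r ?mul0r.
rewrite (fps_mulE_pick _ _ (fun a' => monom b (m `\` a')%mset)) in_submsets /monom.
case: ifPn => am; last by case: eqP => // /esym/msubset_addl; rewrite (negbTE am).
congr (Posz (nat_of_bool _)); apply/eqP/eqP => [->|<-]; last by rewrite msetBDKC.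
by apply/msetP => i; rewrite !msetE2 addKn.
Qed.

Lemma monom0 : monom mset0 = 1.
Proof. by []. Qed.

Lemma prod_monom (I : Type) (s : seq I) (k : I -> nat) :
  \prod_(u <- s) monom [mset k u]%mset = monom (seq_mset (map k s)).
Proof.
elim: s => [|u s IH].
  rewrite big_nil.
  have E : seq_mset (map k [::]) = mset0 by apply/msetP => i; rewrite mset_seqE mset0E.
  by rewrite E monom0.
rewrite big_cons IH.
rewrite map_cons.
rewrite mset_cons.
by rewrite monomD.
Qed.

Lemma fps_sumE (I : Type) (s : seq I) (P : pred I) (F : I -> fps) m :
  (\sum_(i <- s | P i) F i) m = \sum_(i <- s | P i) F i m.
Proof. by elim/big_rec2: _ => // i y1 y2 _ <-. Qed.

Lemma sum_monom (I : finType) (P : pred I) (F : I -> {mset nat}) m :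
  (\sum_(i | P i) monom (F i)) m = #|[set i | P i & F i == m]|%:Z.
Proof.
rewrite fps_sumE /monom.
under eq_bigr do rewrite eq_sym.
rewrite -(big_morph Posz PoszD (erefl 0%:Z)) -sum1_card; congr Posz.
rewrite -big_mkcondr/=; apply: eq_bigl => i; by rewrite inE.
Qed.

(** This is the substitution of zero for every variable outside [A], which explains why it respects
    products. *)
Definition truncate (A : {fset nat}) (f : fps) : fps :=
  fun m => if (finsupp m `<=` A)%fset then f m else 0.

Section Truncate.
Variable A : {fset nat}.

Lemma truncateB : {morph truncate A : f g / f - g}.
Proof.
move=> f g; apply/funext => m; rewrite /truncate.
have E (f1 g1 : fps) : (f1 - g1) m = f1 m - g1 m by [].
by rewrite !E; case: ifP; rewrite ?subrr.
Qed.

Lemma finsupp_msubset (a m : {mset nat}) :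
  (a `<=` m)%mset -> (finsupp a `<=` finsupp m)%fset.
Proof.
by move=> /msubset_subset am; apply/fsubsetP => i; rewrite !msuppE; apply: am.
Qed.

Lemma truncateM : {morph truncate A : f g / f * g}.
Proof.
move=> f g; apply/funext => m; rewrite /truncate.
have E (f1 g1 : fps) : (f1 * g1) m = fps_mul f1 g1 m by [].
rewrite !E /fps_mul; case: ifPn => mA.
  rewrite big_seq [RHS]big_seq; apply: eq_bigr => a; rewrite in_submsets => am.
  rewrite (fsubset_trans (finsupp_msubset am) mA).
  rewrite (fsubset_trans _ mA)//; apply: finsupp_msubset.
  by apply/msubsetP => i; rewrite msetE2 leq_subr.
(* If [m] involves a variable outside [A], then so does one factor in every factorization of [m]. *)
rewrite big_seq big1// => a; rewrite in_submsets => am.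
case: ifPn => aA; rewrite ?mul0r//; case: ifPn => bA; rewrite ?mulr0//.
case/negP: mA; apply/fsubsetP => i; rewrite msuppE -(msetBDKC am) in_msetD.
by rewrite -!msuppE => /orP[/(fsubsetP aA)|/(fsubsetP bA)].
Qed.

Lemma truncate1 : truncate A 1 = 1.
Proof.
apply/funext => m; rewrite /truncate -monom0 /monom.
by case: eqP => [->|_]; [rewrite ifT// finsupp0 fsub0set | case: ifP].
Qed.

HB.instance Definition _ := GRing.isZmodMorphism.Build fps fps (truncate A) truncateB.
HB.instance Definition _ := GRing.isMonoidMorphism.Build fps fps (truncate A)
  (conj truncate1 truncateM).

Definition var (a : A) : fps := monom [mset val a]%mset.

Lemma finsupp_seq_mset (s : seq nat) : finsupp (seq_mset s) =i s.
Proof. by move=> i; rewrite msuppE (perm_mem (perm_eq_seq_mset _)). Qed.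

Lemma truncate_chromsym (G : sgraph) :
  truncate A (chromsym G) = color_sum var G.
Proof.
apply/funext => m; rewrite /color_sum /truncate /chromsym.
have -> : \sum_(k : {ffun G -> A} | proper_coloring k) \prod_u var (k u) =
   \sum_(k : {ffun G -> A} | proper_coloring k)
     monom (coloring_monomial (fun u => val (k u))).
  apply: eq_bigr => k _; rewrite /coloring_monomial codomE -prod_monom.
  by rewrite big_enum.
rewrite sum_monom; case: ifPn => mA; last first.
  rewrite [X in #|pred_of_set X|](_ : _ = set0) ?cards0//; apply/setP => k; rewrite !inE.
  apply/negP => /andP[_ /eqP km]; case/negP: mA; apply/fsubsetP => i.
  by rewrite -km finsupp_seq_mset => /codomP[u ->]; apply: valP.
congr Posz.
(* Enlarging the color set from the support of [m] to [A] adds no coloring with monomial [m], since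
   such a coloring only uses colors from that support. *)
pose h (k : {ffun G -> finsupp m}) : {ffun G -> A} := [ffun u => fincl mA (k u)].
have h_inj : injective h.
  move=> k1 k2 /ffunP E; apply/ffunP => u; have := E u; rewrite !ffunE.
  exact: fincl_inj.
have hval (k : {ffun G -> finsupp m}) : (fun u => val (h k u)) = (fun u => val (k u)).
  by apply/funext => u; rewrite ffunE.
have properE (T : choiceType) (B : {fset T}) (k : {ffun G -> B}) :
    proper_coloring k = proper_coloring (fun u => val (k u)).
  by apply: eq_forallb => u; apply: eq_forallb => w; rewrite (inj_eq val_inj).
rewrite -(card_imset _ h_inj); congr #|pred_of_set _|; apply/setP => k.
rewrite inE properE; apply/imsetP/idP => [[k']|/andP[pk /eqP km]].
  by rewrite inE => km ->; rewrite hval.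
have kin u : val (k u) \in finsupp m by rewrite -km coloring_supp.
have E : k = h [ffun u => [` kin u]%fset].
  by apply/ffunP => u; apply/val_inj; rewrite !ffunE.
exists [ffun u => [` kin u]%fset] => //.
by rewrite inE -hval -E pk km /=.
Qed.

Lemma truncate_elsym (j : nat) : truncate A (elsym j) = esum var j.
Proof.
apply/funext => m; rewrite /esum /truncate /elsym.
have -> : \sum_(S : {set A} | #|S| == j) \prod_(i in S) var i =
   \sum_(S : {set A} | #|S| == j) monom (seq_mset (map val (enum S))).
  by apply: eq_bigr => S _; rewrite -prod_monom big_enum.
rewrite sum_monom.
have memS (S : {set A}) : seq_mset (map val (enum S)) = m ->
    S = [set a : A | val a \in finsupp m].
  move=> Sm; apply/setP => a; rewrite inE -Sm finsupp_seq_mset.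
  by rewrite (mem_map val_inj) mem_enum.
have permS (S : {set A}) : seq_mset (map val (enum S)) = m ->
    perm_eq m (map val (enum S)).
  by move=> <-; apply: perm_eq_seq_mset.
(* By [memS] only the support of [m] can contribute, so the coefficient is 1 exactly when [m] is a
   squarefree monomial of degree [j] in the variables of [A], and 0 otherwise. *)
case: (boolP [&& (finsupp m `<=` A)%fset, size m == j & uniq m]) => [|cond].
  move=> /and3P[mA sm um]; rewrite mA sm um.
  pose S0 := [set a : A | val a \in finsupp m].
  have S0m : seq_mset (map val (enum S0)) = m.
    rewrite -[RHS]seq_mset_id; apply/eq_seq_msetP/uniq_perm => //.
      by rewrite map_inj_uniq ?enum_uniq//; apply: val_inj.
    move=> i; apply/mapP/idP => [[a]|im].
      by rewrite mem_enum inE msuppE => am ->.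
    have iA : i \in A by apply: (fsubsetP mA); rewrite msuppE.
    by exists [` iA]%fset; rewrite ?mem_enum ?inE /= ?msuppE.
  rewrite [X in #|pred_of_set X|](_ : _ = [set S0]) ?cards1//; apply/setP => S.
  rewrite !inE; apply/andP/eqP => [[_ /eqP/memS]//|->]; rewrite S0m eqxx.
  by rewrite -(eqP sm) (perm_size (permS _ S0m)) size_map cardE.
rewrite [X in #|pred_of_set X|](_ : _ = set0).
  by rewrite cards0; move: cond; case: ifP => //= _ /negbTE ->.
apply/setP => S; rewrite !inE; apply/negP => /andP[/eqP Sj /eqP Sm].
case/negP: cond; have := permS _ Sm => pS; apply/and3P; split.
- apply/fsubsetP => i; rewrite msuppE (perm_mem pS) => /mapP[a _ ->].
  exact: valP.
- by rewrite (perm_size pS) size_map -cardE Sj.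
- by rewrite (perm_uniq pS) map_inj_uniq ?enum_uniq//; apply: val_inj.
Qed.

End Truncate.

(** The coefficient of [m] is visible as soon as [A] contains the support of [m]. *)
Lemma truncate_inj (f g : fps) : (forall A, truncate A f = truncate A g) -> f = g.
Proof.
move=> fg; apply/funext => m; have := congr1 (@^~ m) (fg (finsupp m)).
by rewrite /truncate fsubset_refl.
Qed.

(** * Colorings of paths and of twinned paths as words *)

Section ColorSum.
Variables (R : comNzRingType) (T : finType) (x : T -> R).

Definition ffun_option (I : finType) (a : T) (k : {ffun I -> T}) :
  {ffun option I -> T} := [ffun o => oapp k a o].

Lemma sum_ffun_option (I : finType) (P : pred {ffun option I -> T}) :
  \sum_(k | P k) \prod_u x (k u) =
  \sum_a x a * \sum_(k : {ffun I -> T} | P (ffun_option a k)) \prod_u x (k u).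
Proof.
under [RHS]eq_bigr do rewrite mulr_sumr.
rewrite pair_big_dep /=.
rewrite (reindex (fun p : T * {ffun I -> T} => ffun_option p.1 p.2)) /=; last first.
  exists (fun k : {ffun option I -> T} => (k None, [ffun i => k (Some i)])).
    move=> [a k] _ /=; rewrite !ffunE /=; congr (_, _).
    by apply/ffunP => i; rewrite !ffunE.
  by move=> k _; apply/ffunP => -[i|]; rewrite !ffunE /= ?ffunE.
apply: eq_bigr => -[a k] _ /=.
rewrite (bigD1 None) //= ffunE; congr (_ * _).
rewrite (reindex_omap Some id) /=; last by case.
by apply: eq_big => [u|u _]; rewrite ?eqxx// ffunE.
Qed.

Lemma color_sum_iso (G H : sgraph) (f : G -> H) : bijective f ->
  (forall u w, adj (f u) (f w) = adj u w) -> color_sum x G = color_sum x H.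
Proof.
move=> bf adjf; have [g fK gK] := bf; rewrite /color_sum.
rewrite (reindex (fun k : {ffun H -> T} => [ffun u => k (f u)])) /=; last first.
  exists (fun k : {ffun G -> T} => [ffun u => k (g u)]) => k _.
    by apply/ffunP => u; rewrite !ffunE gK.
  by apply/ffunP => u; rewrite !ffunE fK.
apply: eq_big => [k|k _]; last first.
  rewrite [RHS](reindex f) /=; last exact: onW_bij.
  by apply: eq_bigr => u _; rewrite ffunE.
apply/forallP/forallP => pk u; apply/forallP => w; apply/implyP => uw.
  have /forallP/(_ (g w))/implyP := pk (g u).
  by rewrite !ffunE !gK; apply; rewrite -adjf !gK.
rewrite !ffunE; have /forallP/(_ (f w))/implyP := pk (f u).
by apply; rewrite adjf.
Qed.

Lemma sum_ffun_ordS n (P : pred {ffun 'I_n.+1 -> T}) :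
  \sum_(k | P k) \prod_u x (k u) =
  \sum_a x a * \sum_(k : {ffun 'I_n -> T}
     | P [ffun i => oapp k a (unlift ord0 i)]) \prod_u x (k u).
Proof.
pose f (o : option 'I_n) : 'I_n.+1 := oapp (lift ord0) ord0 o.
have fK : cancel f (unlift ord0) by case=> [i|] /=; rewrite ?liftK ?unlift_none.
have gK : cancel (unlift ord0) f by move=> i; rewrite /f; case: unliftP => [j|] ->.
rewrite (reindex (fun k : {ffun option 'I_n -> T} =>
  [ffun i => k (unlift ord0 i)])) /=; last first.
  exists (fun k : {ffun 'I_n.+1 -> T} => [ffun o => k (f o)]) => k _.
    by apply/ffunP => u; rewrite !ffunE fK.
  by apply/ffunP => u; rewrite !ffunE gK.
transitivity (\sum_(k : {ffun option 'I_n -> T} | P [ffun i => k (unlift ord0 i)])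
    \prod_u x (k u)).
  apply: eq_bigr => k _; rewrite (reindex f) /=; last by exists (unlift ord0).
  by apply: eq_bigr => o _; rewrite ffunE fK.
rewrite sum_ffun_option; apply: eq_bigr => a _; congr (_ * _).
apply: eq_bigl => k; congr P; by apply/ffunP => i; rewrite !ffunE.
Qed.

(** The quantified form is vacuously true for [n = 0], matching the value 1 of [word_sum] on the
    empty word. *)
Definition first_avoids n (D : {set T}) (k : 'I_n -> T) : bool :=
  [forall i : 'I_n, (i == 0 :> nat) ==> (k i \notin D)].

(** The new vertex 0 has at most one neighbor, namely the former first vertex. *)
Lemma proper_path_cons n (a : T) (k : {ffun 'I_n -> T}) :
  @proper_coloring (path_graph n.+1) T [ffun i => oapp k a (unlift ord0 i)] =
  @proper_coloring (path_graph n) T k && first_avoids [set a] k.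
Proof.
have k0 : [ffun i => oapp k a (unlift ord0 i)] ord0 = a by rewrite ffunE unlift_none.
have kS i : [ffun i => oapp k a (unlift ord0 i)] (lift ord0 i) = k i.
  by rewrite ffunE liftK.
apply/forallP/andP => [pk|[pk fk] u].
  split; apply/forallP => i.
    apply/forallP => j; apply/implyP => ij.
    have /forallP/(_ (lift ord0 j))/implyP := pk (lift ord0 i).
    by rewrite !kS; apply.
  apply/implyP => i0; have /forallP/(_ (lift ord0 i))/implyP := pk ord0.
  rewrite k0 kS inE eq_sym; apply.
  by rewrite /= /path_adj /= (eqP i0).
apply/forallP => w.
case: (unliftP ord0 u) => [i|] ->; case: (unliftP ord0 w) => [j|] -> /=.
- by rewrite !kS; have /forallP/(_ j) := forallP pk i.
- rewrite kS k0; have := forallP fk i.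
  by rewrite inE /path_adj /= /bump /=; case: (nat_of_ord i).
- rewrite kS k0; have := forallP fk j.
  by rewrite inE [k j == a]eq_sym /path_adj /= /bump /=; case: (nat_of_ord j).
- by rewrite /path_adj.
Qed.

Lemma word_sumE n (D : {set T}) :
  \sum_(k : {ffun 'I_n -> T} | @proper_coloring (path_graph n) T k &&
     first_avoids D k) \prod_u x (k u) = word_sum x n D.
Proof.
elim: n D => [|n IH] D.
  rewrite (eq_bigl predT) => [|k]; last by rewrite -[RHS]andTb; congr (_ && _);
    apply/forallP => -[].
  under eq_bigr do rewrite big_ord0.
  by rewrite sumr_const card_ffun card_ord expn0.
rewrite sum_ffun_ordS /= [RHS]big_mkcond; apply: eq_bigr => a _.
have fa (k : {ffun 'I_n -> T}) :
    first_avoids D [ffun i : 'I_n.+1 => oapp k a (unlift ord0 i)] = (a \notin D).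
  apply/forallP/idP => [/(_ ord0)|aD i]; first by rewrite ffunE unlift_none.
  by apply/implyP => /eqP i0; rewrite (_ : i = ord0) ?ffunE ?unlift_none//; apply/val_inj.
case: ifPn => aD; last by rewrite big_pred0 ?mulr0// => k; rewrite fa (negbTE aD) andbF.
rewrite -IH; congr (_ * _); apply: eq_bigl => k.
by rewrite fa aD andbT proper_path_cons.
Qed.

Lemma color_sum_path n : color_sum x (path_graph n) = word_sum x n set0.
Proof.
rewrite -word_sumE; apply: eq_bigl => k; rewrite andbC.
suff -> : first_avoids set0 k by [].
by apply/forallP => i; rewrite inE implybT.
Qed.

(** The color [a] of the new vertex and the color [b] of the end vertex are split off in turn; these
    two vertices are adjacent, and their only other possible neighbor is the next vertex of the
    path. *)
Lemma color_sum_twin0 n :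
  color_sum x (@twin (path_graph n.+1) ord0) = twin_sum x n.
Proof.
rewrite /color_sum sum_ffun_option; apply: eq_bigr => a _.
rewrite sum_ffun_ordS /= mulr_sumr [RHS]big_mkcond; apply: eq_bigr => b _.
have twinE (k : {ffun 'I_n -> T}) :
   @proper_coloring (@twin (path_graph n.+1) ord0) T
     (ffun_option a [ffun i => oapp k b (unlift ord0 i)]) =
   (b != a) && (@proper_coloring (path_graph n) T k && first_avoids [set a; b] k).
  have -> : first_avoids [set a; b] k = first_avoids [set b] k && first_avoids [set a] k.
    apply/forallP/andP => [f|[/forallP fb /forallP fa] i].
      by split; apply/forallP => i; have := f i; rewrite !inE negb_or;
        case: (_ == 0%N) => //= /andP[].
    by have := fb i; have := fa i; rewrite !inE negb_or; case: (_ == 0%N) => //= -> ->.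
  rewrite [X in _ && X]andbA -proper_path_cons.
  set k1 := [ffun i => _].
  have k10 : k1 ord0 = b by rewrite ffunE unlift_none.
  have k1S i : k1 (lift ord0 i) = k i by rewrite ffunE liftK.
  apply/forallP/and3P => [pk|[ba pk fa]].
    split.
    - have /forallP/(_ None)/implyP := pk (Some ord0).
      by rewrite ![ffun_option _ _ _]ffunE /= k10; apply.
    - apply/forallP => u; apply/forallP => w.
      by have /forallP/(_ (Some w)) := pk (Some u); rewrite ![ffun_option _ _ _]ffunE.
    - apply/forallP => i; apply/implyP => i0.
      have /forallP/(_ None)/implyP := pk (Some (lift ord0 i)).
      rewrite ![ffun_option _ _ _]ffunE /= k1S inE; apply.
      by rewrite /path_adj /= /bump /= (eqP i0).
  (* This serves both orientations of an edge at the new vertex. *)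
  have key w : @twin_adj (path_graph n.+1) ord0 None (Some w) -> k1 w != a.
    rewrite /=; case: (unliftP ord0 w) => [i|] ->; last by rewrite k10.
    rewrite k1S -val_eqE /path_adj /= /bump /= => i0.
    by have := forallP fa i; rewrite inE => /implyP; apply; lia.
  case=> [u|]; apply/forallP => -[w|]; apply/implyP.
  - rewrite ![ffun_option _ _ _]ffunE /= => uw.
    by have /forallP/(_ w)/implyP := forallP pk u; apply.
  - by rewrite ![ffun_option _ _ _]ffunE /= => uw; apply: key.
  - by rewrite ![ffun_option _ _ _]ffunE /= => uw; rewrite eq_sym; apply: key.
  - by [].
case: ifPn => ba; last by rewrite big_pred0 ?mulr0// => k; rewrite twinE (negbTE ba).
by rewrite -mulrA -word_sumE; congr (_ * (_ * _)); apply: eq_bigl => k; rewrite twinE ba.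
Qed.

(** An inner vertex has the two distinct neighbors [v.-1] and [v.+1]. *)
Lemma leaf_path n (v : path_graph n.+2) : leaf v -> v = ord0 \/ v = ord_max.
Proof.
move=> /cards1P[w /setP wE]; have [|v0] := eqVneq v ord0; first by left.
have [|vm] := eqVneq v ord_max; first by right.
have v1 : (0 < v)%N by rewrite lt0n; apply: contra v0 => /eqP v0; apply/eqP/val_inj.
have v2 : (v < n.+1)%N.
  rewrite ltn_neqAle -ltnS ltn_ord andbT.
  by apply: contra vm => /eqP vm; apply/eqP/val_inj.
have lt1 : (v.-1 < n.+2)%N by lia.
have lt2 : (v.+1 < n.+2)%N by lia.
have := wE (Ordinal lt1); have := wE (Ordinal lt2).
rewrite !inE /= /path_adj /= eqxx prednK// eqxx orbT.
by move=> /esym/eqP E1 /esym/eqP E2; have := congr1 val (etrans E1 (esym E2)) => /=; lia.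
Qed.

(** Reversing the path exchanges its two ends. The single vertex of a one-vertex path has degree 0,
    hence the guard on the leaf condition. *)
Lemma color_sum_twin n (v : path_graph n.+1) : ((0 < n)%N -> leaf v) ->
  color_sum x (twin v) = twin_sum x n.
Proof.
move=> lv; suff [->|->] : v = ord0 \/ v = ord_max.
- exact: color_sum_twin0.
- rewrite -color_sum_twin0.
  apply: (@color_sum_iso (@twin (path_graph n.+1) ord_max)
    (@twin (path_graph n.+1) ord0) (omap (@rev_ord n.+1))).
    exists (omap (@rev_ord n.+1)); by case=> //= i; rewrite rev_ordK.
  have rev_adj (i j : 'I_n.+1) : path_adj (rev_ord i) (rev_ord j) = path_adj i j.
    by rewrite /path_adj /=; have := ltn_ord i; have := ltn_ord j; lia.
  have rev_max : rev_ord (@ord_max n) = ord0 by apply/val_inj; rewrite /= subnn.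
  by case=> [u|] [w|] //=; rewrite -rev_max rev_adj (inj_eq rev_ord_inj).
case: n v lv => [|n] v lv; first by left; rewrite ord1.
exact/leaf_path/lv.
Qed.

End ColorSum.

(** * Path and twin identities lifted to power series *)

Lemma chromsym_path0 : chromsym (path_graph 0) = 1.
Proof.
by apply: truncate_inj => A; rewrite truncate_chromsym color_sum_path rmorph1.
Qed.

Lemma chromsym_path_rec n : chromsym (path_graph n.+1) = elsym n.+1 +
  \sum_(2 <= j < n.+2) (j - 1)%:R * elsym j * chromsym (path_graph (n.+1 - j)).
Proof.
apply: truncate_inj => A.
rewrite rmorphD rmorph_sum /= truncate_elsym.
rewrite truncate_chromsym color_sum_path word_sum_rec.
congr (_ + _); apply: eq_bigr => j _.
by rewrite !rmorphM /= rmorph_nat truncate_elsym truncate_chromsym color_sum_path.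
Qed.

Lemma chromsym_path1 : chromsym (path_graph 1) = elsym 1.
Proof. by rewrite chromsym_path_rec big_geq// addr0. Qed.

Lemma chromsym_path2 : chromsym (path_graph 2) = 2%:R * elsym 2.
Proof.
by rewrite chromsym_path_rec big_nat1 chromsym_path0 subn1 mul1r mulr1 mulr_natl.
Qed.

Lemma chromsym_twin_path1 (v : path_graph 1) : chromsym (twin v) = 2%:R * elsym 2.
Proof.
rewrite -chromsym_path2; apply: truncate_inj => A.
by rewrite !truncate_chromsym color_sum_twin// color_sum_path twin_sum0.
Qed.

Lemma chromsym_twin_path n (v : path_graph n.+2) : leaf v ->
  chromsym (twin v) = 2%:R * (chromsym (path_graph n.+3)
                              - elsym 2 * chromsym (path_graph n.+1)).
Proof.
move=> lv; rewrite mulrBr mulrA -chromsym_path2; apply: truncate_inj => A.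
rewrite rmorphB !rmorphM /= rmorph_nat !truncate_chromsym !color_sum_path.
by rewrite color_sum_twin// twin_sumS.
Qed.

(** * Closure properties for e-positivity *)

Definition e_nat_sum (f : fps) : Prop :=
  exists2 s : seq (seq nat), all (fun la => 0%N \notin la) s &
    f = \sum_(la <- s) elsym_part la.

(** Unsorted lists with repetition make sums a concatenation and multiplication by [elsym j] a
    [cons]. Sorting each list yields partitions, and multiplicities become the coefficients. *)
Lemma e_nat_sum_positive f : e_nat_sum f -> e_positive f.
Proof.
move=> [s s0 ->].
pose s' := map (sort geq) s.
have s'_part la : la \in s' -> is_partition la.
  case/mapP => mu mus ->; rewrite /is_partition mem_sort (allP s0)// andbT.
  by apply: sort_sorted => i j; apply: leq_total.
pose c : {fsfun seq nat -> int with 0} :=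
  [fsfun la in [fset la in s']%fset => (count_mem la s')%:Z].
have cE la : c la = (count_mem la s')%:Z.
  rewrite fsfunE in_fset /=; case: ifPn => // /count_memPn -> //.
have suppE : finsupp c =i s'.
  by move=> la; rewrite mem_finsupp cE eqz_nat -lt0n -has_count has_pred1.
exists c; split; last by move=> la; rewrite cE.
split=> [la|]; first by rewrite suppE; apply: s'_part.
transitivity (\sum_(la <- s') elsym_part la).
  rewrite big_map; apply: eq_bigr => la _; apply: perm_big.
  by rewrite perm_sym perm_sort.
(* Equal partitions are grouped, each taken as often as it occurs. *)
rewrite -big_undup_iterop_count.
rewrite (perm_big (finsupp c)) /=; last first.
  by apply: uniq_perm; rewrite ?undup_uniq ?fset_uniq// => la; rewrite mem_undup suppE.
by apply: eq_bigr => la _; rewrite cE -pmulrn mulr_natl.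
Qed.

Lemma e_nat_sum1 : e_nat_sum 1.
Proof. by exists [:: [::]] => //; rewrite big_seq1 /elsym_part big_nil. Qed.

Lemma e_nat_sumD f g : e_nat_sum f -> e_nat_sum g -> e_nat_sum (f + g).
Proof.
move=> [s s0 ->] [t t0 ->]; exists (s ++ t); first by rewrite all_cat s0.
by rewrite big_cat.
Qed.

Lemma e_nat_sum_sum (I : eqType) (r : seq I) (F : I -> fps) :
  (forall i, i \in r -> e_nat_sum (F i)) -> e_nat_sum (\sum_(i <- r) F i).
Proof.
move=> rF; rewrite big_seq; elim/big_ind: _ => //; last exact: e_nat_sumD.
by exists [::]; rewrite ?big_nil.
Qed.

Lemma e_nat_sum_natM n f : e_nat_sum f -> e_nat_sum (n%:R * f).
Proof.
move=> hf; rewrite mulr_natl -[n]subn0 -sumr_const_nat.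
exact: e_nat_sum_sum.
Qed.

Lemma e_nat_sumM j f : (0 < j)%N -> e_nat_sum f -> e_nat_sum (elsym j * f).
Proof.
move=> j0 [s s0 ->]; exists (map (cons j) s).
  rewrite all_map; apply: sub_all s0 => la /=.
  by rewrite inE negb_or => ->; rewrite andbT eq_sym -lt0n.
rewrite big_map mulr_sumr; apply: eq_bigr => la _.
by rewrite /elsym_part big_cons.
Qed.

Lemma e_nat_sum_elsym j : (0 < j)%N -> e_nat_sum (elsym j).
Proof. by move=> j0; rewrite -[elsym j]mulr1; apply/e_nat_sumM/e_nat_sum1. Qed.

Lemma e_nat_sum_path n : e_nat_sum (chromsym (path_graph n)).
Proof.
elim/ltn_ind: n => -[_|n IH]; first by rewrite chromsym_path0; apply: e_nat_sum1.
rewrite chromsym_path_rec; apply: e_nat_sumD; first exact: e_nat_sum_elsym.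
apply: e_nat_sum_sum => j; rewrite mem_index_iota => /andP[j2 jn].
rewrite -mulrA; apply/e_nat_sum_natM/e_nat_sumM; first exact: ltn_trans j2.
by apply: IH; lia.
Qed.

(** * Expansion and recurrence for twinned paths *)

Lemma chromsym_twin_path_sum n (v : path_graph n.+2) : leaf v ->
  chromsym (twin v) = (2 * n.+3)%:R * elsym n.+3 +
    2%:R * \sum_(3 <= j < n.+3)
      (j - 1)%:R * elsym j * chromsym (path_graph (n.+3 - j)).
Proof.
move=> lv; rewrite (chromsym_twin_path lv) chromsym_path_rec.
(* The term [j = 2] cancels the subtracted product with [elsym 2]; the term [j = n.+3] joins the
   free [elsym n.+3], giving [1 + n.+2]. *)
rewrite big_ltn// big_nat_recr//= subnn chromsym_path0 !subSS !subn0.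
by rewrite natrM -[n.+3%:R]natr1; ring.
Qed.

(** The path recurrence is applied to both paths in [chromsym_twin_path]. Terms with [j] at most
    [n.+2] recombine into twinned paths; the others give the boundary terms, where the coefficient
    of [elsym n.+3 * elsym 2] is [4 (n + 2) - 2 (n + 3) = 2 (n + 1)]. *)
Lemma chromsym_twin_path_rec (n : nat) (v : forall m, path_graph m.+1) :
  (forall m, (0 < m)%N -> leaf (v m)) ->
  chromsym (twin_path v n.+4) =
    \sum_(2 <= j < n.+3) (j - 1)%:R * elsym j * chromsym (twin_path v (n.+4 - j))
    + (2 * n.+4.+1)%:R * elsym n.+4.+1 + (2 * n.+3)%:R * elsym n.+4 * elsym 1
    + (2 * n.+1)%:R * elsym n.+3 * elsym 2.
Proof.
move=> hv; rewrite /= (chromsym_twin_path (hv _ _))//.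
pose P n := chromsym (path_graph n).
have -> : \sum_(2 <= j < n.+3) (j - 1)%:R * elsym j * chromsym (twin_path v (n.+4 - j)) =
    2%:R * (\sum_(2 <= j < n.+3) (j - 1)%:R * elsym j * P (n.+4.+1 - j)%N
       - elsym 2 * \sum_(2 <= j < n.+3) (j - 1)%:R * elsym j * P (n.+3 - j)%N).
  rewrite mulr_sumr -sumrB mulr_sumr big_nat_cond [RHS]big_nat_cond.
  apply: eq_bigr => j /andP[/andP[j2 jn] _].
  (* The range of [j] leaves at least two vertices, so the twin formula applies to each summand. *)
  have [m mE] : exists m, (n.+4 - j = m.+2)%N by exists (n.+4 - j).-2; lia.
  rewrite (_ : n.+4.+1 - j = m.+3)%N; last by lia.
  rewrite (_ : n.+3 - j = m.+1)%N; last by lia.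
  by rewrite mE /= (chromsym_twin_path (hv _ _))// /P; ring.
have recr1 (F : nat -> fps) :
    \sum_(2 <= j < n.+4) F j = \sum_(2 <= j < n.+3) F j + F n.+3.
  by rewrite big_nat_recr.
have recr3 (F : nat -> fps) : \sum_(2 <= j < n.+4.+2) F j =
    \sum_(2 <= j < n.+3) F j + F n.+3 + F n.+4 + F n.+4.+1.
  by rewrite big_nat_recr//= big_nat_recr//= recr1.
rewrite [chromsym (path_graph n.+4.+1)]chromsym_path_rec recr3.
rewrite [chromsym (path_graph n.+3)]chromsym_path_rec recr1 -!/(P _).
rewrite !subnn (_ : n.+4.+1 - n.+3 = 2)%N; last by lia.
rewrite (_ : n.+4.+1 - n.+4 = 1)%N; last by lia.
rewrite (chromsym_path0 : P 0%N = 1) (chromsym_path1 : P 1%N = _).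
rewrite (chromsym_path2 : P 2%N = _) !subSS !subn0.
rewrite !natrM -[n.+4.+1%:R]natr1 -[n.+4%:R]natr1 -[n.+3%:R]natr1 -[n.+2%:R]natr1.
by ring.
Qed.

Theorem proposition4p2
  (v : forall m : nat, path_graph m.+1)
  (hv : forall m : nat, (0 < m)%N -> leaf (v m)) :
  let XP (n : nat) : fps := chromsym (path_graph n) in
  let XPv (n : nat) : fps := chromsym (twin_path v n) in
  (forall n : nat, (4 <= n)%N ->
     XPv n = (2 * (n + 1))%:R * elsym (n + 1)
             + 2%:R * \sum_(3 <= j < n.+1)
                        (j - 1)%:R * elsym j * XP (n + 1 - j)%N)
  /\ (forall n : nat, (1 <= n)%N -> e_positive (XPv n))
  /\ (forall n : nat, (4 <= n)%N ->
        XPv n = \sum_(2 <= j < (n - 2).+1)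
                   (j - 1)%:R * elsym j * XPv (n - j)%N
                + (2 * (n + 1))%:R * elsym (n + 1)
                + (2 * (n - 1))%:R * elsym n * elsym 1
                + (2 * (n - 3))%:R * elsym (n - 1) * elsym 2
        /\ (forall j : nat, (2 <= j <= n - 2)%N ->
              e_positive ((j - 1)%:R * elsym j * XPv (n - j)%N))
        /\ e_positive ((2 * (n + 1))%:R * elsym (n + 1)
                       + (2 * (n - 1))%:R * elsym n * elsym 1
                       + (2 * (n - 3))%:R * elsym (n - 1) * elsym 2))
  /\ XPv 1%N = 2%:R * elsym 2
  /\ XPv 2%N = 6%:R * elsym 3
  /\ XPv 3%N = 8%:R * elsym 4 + 4%:R * elsym 3 * elsym 1.
Proof.
move=> XP XPv.
have XPv_pos n : (0 < n)%N -> e_nat_sum (XPv n).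
  case: n => [//|[|n]] _; rewrite /XPv /=.
    rewrite chromsym_twin_path1; exact/e_nat_sum_natM/e_nat_sum_elsym.
  rewrite (chromsym_twin_path_sum (hv n.+1 isT)); apply: e_nat_sumD.
    exact/e_nat_sum_natM/e_nat_sum_elsym.
  apply/e_nat_sum_natM/e_nat_sum_sum => j.
  rewrite mem_index_iota => /andP[j3 _]; rewrite -mulrA.
  apply/e_nat_sum_natM/e_nat_sumM; first exact: ltn_trans j3.
  exact: e_nat_sum_path.
split=> [[//|[//|n]] _|].
  by rewrite addn1; exact: (chromsym_twin_path_sum (hv n.+1 isT)).
split=> [n n0|]; first exact/e_nat_sum_positive/XPv_pos.
split=> [[//|[//|[//|[//|n]]]] _|].
  split.
    rewrite addn1 !subSS !subn0; exact: chromsym_twin_path_rec.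
  split=> [j /andP[j2 jn]|]; apply: e_nat_sum_positive.
    rewrite -mulrA; apply/e_nat_sum_natM/e_nat_sumM; first exact: ltn_trans j2.
    by apply: XPv_pos; lia.
  rewrite -!mulrA; apply: e_nat_sumD; first apply: e_nat_sumD;
    apply/e_nat_sum_natM.
  - exact/e_nat_sum_elsym.
  - exact/e_nat_sumM/e_nat_sum_elsym.
  - exact/e_nat_sumM/e_nat_sum_elsym.
split; first exact: chromsym_twin_path1.
(* In the expansion, the sum over [j] is empty for two vertices and has the single term [j = 3] for
   three. *)
split; rewrite /XPv /= (chromsym_twin_path_sum (hv _ _))//.
  by rewrite big_geq// mulr0 addr0.
by rewrite big_nat1 chromsym_path1 !mulrA -natrM.
Qed.
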